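(* Let $\mathcal{H}$ be a complex Hilbert space and let $E\in\mathcal{B}(\mathcal{H})$ satisfy $E^{2}=E$. Then $$\min\{J\in\mathcal{B}(\mathcal{H}):\ JE\geqslant0,\ J=J^{*}=J^{-1}\}=2P_{(E+E^{*})^{+}}-I,$$ where the minimum is with respect to the Loewner partial order; that is, the operator $2P_{(E+E^{*})^{+}}-I$ belongs to this set and every $J$ in the set satisfies $J\geqslant 2P_{(E+E^{*})^{+}}-I$.
   Context: For a bounded operator $A$ on $\mathcal{H}$, $A\geqslant0$ means $\langle Ax,x\rangle\geqslant0$ for all $x$ (so $A$ is self-adjoint), and for self-adjoint $A,B$ the Loewner order $A\geqslant B$ means $A-B\geqslant0$. For self-adjoint $A$, $A^{+}=\frac{|A|+A}{2}$ with $|A|=(A^{*}A)^{1/2}$. $P_A$ denotes the orthogonal projection onto $\overline{R(A)}$, the closure of the range of $A$. *)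

(* Defs.v *)
From HB Require Import structures.
From mathcomp Require Import all_boot all_order all_algebra.
From mathcomp Require Import complex.
From mathcomp Require Import boolp classical_sets functions reals topology.
From mathcomp Require Import normedtype.

Set Implicit Arguments.
Unset Strict Implicit.
Unset Printing Implicit Defensive.

Import Order.TTheory GRing.Theory Num.Theory.
Import numFieldNormedType.Exports.

Local Open Scope classical_set_scope.
Local Open Scope ring_scope.
Local Open Scope complex_scope.

(* Complex Hilbert spaces: Banach spaces over [R[i]] whose norm comes from an
   inner product.  A form of type [{dot H for theta}] is linear in its first
   argument, [theta]-semilinear in its second one, and positive definite. *)
HB.mixin Record isHilbert (R : realType) H of CompleteNormedModule R[i] H := {
  dot : {dot H for (Num.conj : R[i] -> R[i])};
  dotxx : forall x : H, dot x x = `|x| ^+ 2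
}.

#[short(type="hilbertType")]
HB.structure Definition Hilbert (R : realType) :=
  {H of isHilbert R H & CompleteNormedModule R[i] H}.

Section Operators.
Variables (R : realType) (H : hilbertType R).
Implicit Types (A B J K P : H -> H) (M : set H).

Local Notation "'[ x , y ]" := (dot x y).

Definition bounded_op A :=
  linear A /\ exists c : R[i], forall x, `|A x| <= c * `|x|.

(* In [R[i]], [0 <= z] entails that [z] is real. *)
Definition psd A := bounded_op A /\ forall x, 0 <= '[A x, x].

Definition loewner_le A B := psd (B - A).

(* The definitions by [get] below pick the unique element of the set; existence
   is the Riesz representation theorem for the adjoint, the existence of square
   roots of positive operators for [sqrt_op] (used at positive arguments), and
   the projection theorem for [orth_proj] (used at closed subspaces). *)
Definition adj A : H -> H :=
  get [set B | bounded_op B /\ forall x y, '[A x, y] = '[x, B y]].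

Definition sqrt_op A : H -> H := get [set B | psd B /\ B \o B = A].

Definition abs_op A : H -> H := sqrt_op (adj A \o A).

Definition pos_part A : H -> H := 2^-1 *: (abs_op A + A).

Definition orth_proj M : H -> H :=
  get [set P | [/\ bounded_op P, P \o P = P, adj P = P & range P = M]].

Definition range_proj A : H -> H := orth_proj (closure (range A)).

Definition inverse_op J K := J \o K = id /\ K \o J = id.

Definition loewner_minimum (S : set (H -> H)) J :=
  S J /\ forall K, S K -> loewner_le J K.

End Operators.

(* Main.v *)
Require Import Defs.
From mathcomp Require Import all_boot all_order all_algebra.
From mathcomp Require Import complex ring lra.
From mathcomp Require Import boolp classical_sets functions reals topology.
From mathcomp Require Import normedtype.

Set Implicit Arguments.
Unset Strict Implicit.
Unset Printing Implicit Defensive.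

Import Order.TTheory GRing.Theory Num.Theory.
Import numFieldNormedType.Exports.

Local Open Scope classical_set_scope.
Local Open Scope ring_scope.
Local Open Scope complex_scope.

(** Put [F = E^*] and [K = E + F - 1].  Then [K E = F E], [E K = E F] and
    [K^2 = 1 + (E - F)^*(E - F) >= 1], so [S = (K^2)^(1/2)] is invertible and
    commutes with [E] and [F], and [J = K S^-1] is a symmetry.  Since
    [E + F = K + 1 = J (S + J)] and [S + J >= 0], we have [|E + F| = S + J],
    hence [(E + F)^+ = (1 + J)/2 (1 + S)]; its range is that of the projection
    [(1 + J)/2] because [1 + S] is onto.  So the claimed minimum is [J].
    - [J E = S^-1 F E = F S^-1 E >= 0].
    - If [G] is a symmetry with [G E >= 0], then [G E = F G], so [G] commutes
      with [K] and [J].  A vector [w] with [G w = - w], [J w = w] satisfies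
      [<Ew,w> <= 0] by [G E >= 0] and [<Ew,w> >= 0] by [J E >= 0], so that
      [<Sw,w> = <Kw,w> = - |w|^2] and [w = 0].  Hence [(1 - G)(1 + J) = 0], and
      [G - J = 1 - G J = (G - J)^2 / 2 >= 0]. *)

(** * The real part of the inner product *)

Section RealInnerProduct.
Variables (R : realType) (H : hilbertType R).
Implicit Types (x y z : H) (a : R).

(* Since [Im <x,y> = Re <x,iy>] up to sign, a complex-linear operator has the
   same adjoint for [ip] as for [dot]. *)
Definition ip x y : R := complex.Re (dot x y).
Definition nm x : R := complex.Re `|x|.

Lemma ReD (u v : R[i]) : complex.Re (u + v) = complex.Re u + complex.Re v.
Proof. by case: u v => ? ? [? ?]. Qed.

Lemma ReN (u : R[i]) : complex.Re (- u) = - complex.Re u.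
Proof. by case: u. Qed.

Lemma dotC x y : dot x y = (dot y x)^*.
Proof. by rewrite hermC expr0 mul1r. Qed.

Lemma ipC x y : ip x y = ip y x.
Proof. by rewrite /ip dotC; case: (dot y x). Qed.

Lemma ipDl x y z : ip (x + y) z = ip x z + ip y z.
Proof. by rewrite /ip linearDl ReD. Qed.

Lemma ipNl x z : ip (- x) z = - ip x z.
Proof. by rewrite /ip linearNl ReN. Qed.

Lemma ip0l z : ip 0 z = 0.
Proof. by rewrite /ip linear0l. Qed.

Lemma ipZl a x z : ip (a%:C *: x) z = a * ip x z.
Proof.
by rewrite /ip linearZl_LR /=; case: (dot x z) => b c /=; rewrite mul0r subr0.
Qed.

Lemma ipDr x y z : ip z (x + y) = ip z x + ip z y.
Proof. by rewrite ipC ipDl !(ipC _ z). Qed.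

Lemma ipNr x z : ip z (- x) = - ip z x.
Proof. by rewrite ipC ipNl ipC. Qed.

Lemma ip0r z : ip z 0 = 0.
Proof. by rewrite ipC ip0l. Qed.

Lemma ipZr a x z : ip z (a%:C *: x) = a * ip z x.
Proof. by rewrite ipC ipZl ipC. Qed.

Definition ipE := (ip0l, ip0r, ipDl, ipDr, ipNl, ipNr, ipZl, ipZr).

Lemma dot_ip x y : dot x y = ip x y +i* ip x ('i *: y).
Proof.
rewrite /ip linearZr_LR /=; case: (dot x y) => a b /=.
by congr (_ +i* _); ring.
Qed.

Lemma ip_il x y : ip ('i *: x) y = - ip x ('i *: y).
Proof.
rewrite /ip linearZr_LR linearZl_LR /=; case: (dot x y) => a b /=.
by ring.
Qed.

Lemma nmE x : `|x| = (nm x)%:C.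
Proof. by rewrite /nm RRe_real// ger0_real. Qed.

Lemma nm_ge0 x : 0 <= nm x.
Proof. by have := normr_ge0 x; rewrite nmE lecR. Qed.

Lemma ipxx x : ip x x = nm x ^+ 2.
Proof. by rewrite /ip dotxx nmE -rmorphXn. Qed.

Lemma ipxx_ge0 x : 0 <= ip x x.
Proof. by rewrite ipxx sqr_ge0. Qed.

Lemma nm_triangle x y : nm (x + y) <= nm x + nm y.
Proof. by have := ler_normD x y; rewrite !nmE -rmorphD lecR. Qed.

Lemma nmN x : nm (- x) = nm x.
Proof. by rewrite /nm normrN. Qed.

Lemma nm_distC x y : nm (x - y) = nm (y - x).
Proof. by rewrite -nmN opprB. Qed.

Lemma nm0_eq0 x : nm x = 0 -> x = 0.
Proof. by move=> x0; apply/eqP; rewrite -normr_eq0 nmE x0. Qed.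

Lemma ipxx_eq0 x : ip x x = 0 -> x = 0.
Proof. by rewrite ipxx => /eqP; rewrite sqrf_eq0 => /eqP /nm0_eq0. Qed.

Lemma ip_ext x y : (forall z, ip x z = ip y z) -> x = y.
Proof.
move=> xy; apply/eqP; rewrite -subr_eq0; apply/eqP/ipxx_eq0.
by rewrite ipDl ipNl xy subrr.
Qed.

(** Cauchy-Schwarz, read off from the squared triangle inequality of the norm. *)
Lemma ip_le_nm x y : ip x y <= nm x * nm y.
Proof.
have h : nm (x + y) ^+ 2 <= (nm x + nm y) ^+ 2.
  by rewrite ler_sqr ?nnegrE ?nm_ge0 ?addr_ge0 ?nm_ge0 ?nm_triangle.
rewrite -ipxx !ipE (ipC y x) !ipxx in h; nra.
Qed.

Lemma nm_complete (u : nat -> H) :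
  (forall e : R, 0 < e -> exists N : nat, forall m n : nat,
     (N <= m)%N -> (N <= n)%N -> nm (u m - u n) < e) ->
  exists l : H, forall e : R, 0 < e -> exists N : nat, forall n : nat,
     (N <= n)%N -> nm (u n - l) < e.
Proof.
move=> cu.
have : cauchy (u @ \oo).
  apply: cauchy_exP => e e0.
  have er : e = (complex.Re e)%:C by rewrite RRe_real// gtr0_real.
  have [N hN] := cu (complex.Re e) ltac:(by move: e0; rewrite er ltcR).
  exists (u N), N => // n /= Nn.
  by rewrite -ball_normE /= nmE er ltcR hN.
move=> /cauchy_cvg/cvg_ex [l ul]; exists l => e e0.
have /cvgrPdist_lt/(_ e%:C) := ul.
rewrite ltcR => /(_ e0) [N _ hN]; exists N => n Nn.
by have := hN n Nn; rewrite /= nmE ltcR nm_distC.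
Qed.

End RealInnerProduct.

(** Pairing with an arbitrary vector turns a vector identity with real coefficients into one that
    [lra] can check. *)
Ltac vec := apply: ip_ext => ?; rewrite !ipE; lra.

(** * Bounded operators, Riesz representation and adjoints *)

Section BoundedOperators.
Variables (R : realType) (H : hilbertType R).
Implicit Types (x y z : H) (a : R) (A B : H -> H).

Lemma opD A : bounded_op A -> forall x y, A (x + y) = A x + A y.
Proof. by case=> lA _ x y; have := lA 1 x y; rewrite !scale1r. Qed.

Lemma op0 A : bounded_op A -> A 0 = 0.
Proof. by move=> bA; apply: (addrI (A 0)); rewrite -(opD bA) !addr0. Qed.

Lemma opZ A : bounded_op A -> forall (k : R[i]) x, A (k *: x) = k *: A x.
Proof.
by move=> bA k x; have := (bA.1) k x 0; rewrite !addr0 (op0 bA) addr0.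
Qed.

Lemma opN A : bounded_op A -> forall x, A (- x) = - A x.
Proof. by move=> bA x; rewrite -scaleN1r (opZ bA) scaleN1r. Qed.

Definition opE A (bA : bounded_op A) := (op0 bA, opD bA, opN bA, opZ bA).

Lemma op_bound A : bounded_op A ->
  exists2 c : R, 0 < c & forall x, nm (A x) <= c * nm x.
Proof.
(* The bound is a complex number; its real part already works because norms are real, and adding 1
   makes the constant positive. *)
case=> _ [[c d] hc]; exists (`|c| + 1); first by rewrite ltr_wpDl.
move=> x; have := hc x; rewrite !nmE lecE /= => /andP[_].
rewrite mulr0 subr0 => /le_trans; apply; rewrite ler_wpM2r ?nm_ge0//.
by rewrite (le_trans (ler_norm _))// lerDl.
Qed.

Lemma bounded_opI A (c : R) : linear A -> (forall x, nm (A x) <= c * nm x) ->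
  bounded_op A.
Proof.
by move=> lA hc; split=> //; exists c%:C => x; rewrite !nmE -rmorphM lecR.
Qed.

Lemma bounded_op_id : bounded_op (id : H -> H).
Proof. by apply: (@bounded_opI _ 1) => // x; rewrite mul1r. Qed.

Lemma bounded_opD A B : bounded_op A -> bounded_op B ->
  bounded_op (fun x => A x + B x).
Proof.
move=> bA bB; have [c _ hc] := op_bound bA; have [d _ hd] := op_bound bB.
apply: (@bounded_opI _ (c + d)) => [k x y|x].
  by rewrite !(opE bA) !(opE bB) scalerDr addrACA.
by rewrite (le_trans (nm_triangle _ _))// mulrDl lerD.
Qed.

Lemma nmZ (k : R[i]) x : nm (k *: x) = complex.Re `|k| * nm x.
Proof.
apply: complexI; rewrite -nmE normrZ nmE rmorphM /=.
by rewrite (RRe_real (ger0_real (normr_ge0 k))).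
Qed.

Lemma bounded_opZ (k : R[i]) A : bounded_op A ->
  bounded_op (fun x => k *: A x).
Proof.
move=> bA; have [c _ hc] := op_bound bA.
apply: (@bounded_opI _ (complex.Re `|k| * c)) => [l x y|x].
  by rewrite !(opE bA) scalerDr !scalerA mulrC.
rewrite nmZ -mulrA ler_wpM2l//.
by have := normr_ge0 k; rewrite lecE => /andP[].
Qed.

Lemma bounded_opN A : bounded_op A -> bounded_op (fun x => - A x).
Proof.
move=> /(bounded_opZ (-1)); congr bounded_op.
by apply/funext => x; rewrite scaleN1r.
Qed.

Lemma bounded_opB A B : bounded_op A -> bounded_op B ->
  bounded_op (fun x => A x - B x).
Proof. by move=> bA bB; apply: bounded_opD => //; apply: bounded_opN. Qed.

Lemma bounded_op_comp A B : bounded_op A -> bounded_op B ->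
  bounded_op (fun x => A (B x)).
Proof.
move=> bA bB; have [c c0 hc] := op_bound bA; have [d _ hd] := op_bound bB.
apply: (@bounded_opI _ (c * d)) => [k x y|x].
  by rewrite !(opE bB) !(opE bA).
by rewrite (le_trans (hc _))// -mulrA ler_wpM2l// ltW.
Qed.

(** Real linearity of [B] is automatic for an adjoint; commutation of [B] with ['i] follows from
    that of [A], since ['i] is skew for [ip]. *)
Lemma adjoint_linear A B : (forall x, A ('i *: x) = 'i *: A x) ->
  (forall x y, ip (A x) y = ip x (B y)) -> linear B.
Proof.
move=> Ai AB [p q] u v.
have cE w : (p +i* q) *: w = p%:C *: w + q%:C *: ('i *: w).
  by rewrite scalerA -scalerDl [in LHS](complexE (p +i* q)) /= (mulrC 'i).
apply: ip_ext => z; have BA y w : ip (B w) y = ip (A y) w by rewrite ipC -AB.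
by rewrite BA !cE !ipE ip_il !BA Ai ip_il opprK.
Qed.

Lemma adjoint_bounded A B : bounded_op A ->
  (forall x y, ip (A x) y = ip x (B y)) -> bounded_op B.
Proof.
move=> bA AB; have [c c0 hc] := op_bound bA.
apply: (@bounded_opI _ c); first exact: (adjoint_linear (opZ bA 'i)).
move=> x; have h := ip_le_nm (A (B x)) x; rewrite AB ipxx in h.
have := nm_ge0 (B x); rewrite le_eqVlt => /orP[/eqP <-|B0].
  by rewrite mulr_ge0 ?nm_ge0 ?ltW.
rewrite -(ler_pM2l B0) -expr2 (le_trans h)// mulrA (mulrC (nm _) c).
by rewrite ler_wpM2r ?nm_ge0.
Qed.

Definition symmetric_op A := forall x y, ip (A x) y = ip x (A y).

(** Positivity in [R[i]] makes every [<Az,z>] real, so [ip (A z) ('i *: z)] vanishes; polarizing at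
    [x + 'i *: y] gives symmetry. *)
Lemma psd_symmetric A : psd A -> symmetric_op A.
Proof.
case=> bA A0 x y.
have h z : ip (A z) ('i *: z) = 0.
  by have := A0 z; rewrite dot_ip lecE /= => /andP[/eqP].
have := h (x + 'i *: y); have := h x; have := h ('i *: y).
have ii z : 'i *: ('i *: z) = - z :> H.
  by rewrite scalerA -expr2 sqr_i scaleN1r.
rewrite !(opE bA) scalerDr !ii !ipE !ip_il ii !ipE => h1 h2.
rewrite h2 h1 (ipC (A y)) => /eqP.
by rewrite !addr0 add0r ?opprK (ipC x) addrC subr_eq0 => /eqP ->.
Qed.

Lemma psd_ge0 A x : psd A -> 0 <= ip (A x) x.
Proof. by case=> _ /(_ x); rewrite dot_ip lecE => /andP[]. Qed.

Lemma psdI A : bounded_op A -> symmetric_op A -> (forall x, 0 <= ip (A x) x) ->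
  psd A.
Proof.
move=> bA sA A0; split=> // x; rewrite dot_ip lecE /= A0 andbT.
have : ip (A x) ('i *: x) = - ip (A x) ('i *: x).
  by rewrite [LHS]sA (opE bA) (ipC x) ip_il.
by move=> h; apply/eqP; lra.
Qed.

Lemma quad_ge0_linear (a b : R) :
  (forall t : R, 0 <= 2 * t * a + t ^+ 2 * b) -> a = 0.
Proof.
(* At [t = - a / s] the hypothesis gives [a ^+ 2 * (b - 2 * s) >= 0], while [s >= b] and [s > 0]
   make the second factor negative. *)
move=> h; set s := `|b| + 1.
have s0 : 0 < s by rewrite /s ltr_wpDl.
have bs : b <= s by rewrite /s (le_trans (ler_norm _))// lerDl.
have /(mulr_ge0 (sqr_ge0 s)) := h (- a / s).
have -> : s ^+ 2 * (2 * (- a / s) * a + (- a / s) ^+ 2 * b) =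
          a ^+ 2 * (b - 2 * s) by field; rewrite gt_eqF.
move=> h2; apply/eqP; rewrite -sqrf_eq0; apply/eqP/le_anti.
rewrite sqr_ge0 andbT leNgt; apply/negP => a0.
by move: h2; rewrite pmulr_rge0// leNgt => /negP; apply; lra.
Qed.

(* Minimizing [x |-> <Tx,x> - 2 phi x]: Riesz' theorem for [T = id], and
   surjectivity of coercive symmetric operators. *)
Lemma coercive_representation (T : H -> H) (phi : H -> R) :
  bounded_op T -> symmetric_op T -> (forall x, ip x x <= ip (T x) x) ->
  (forall x y, phi (x + y) = phi x + phi y) ->
  (forall a x, phi (a%:C *: x) = a * phi x) ->
  (exists c : R, forall x, phi x <= c * nm x) ->
  exists w, forall v, ip (T w) v = phi v.
Proof.
move=> bT sT cT phiD phiZ [c' hc'].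
have [c c0 hc] : exists2 c : R, 0 <= c & forall x, phi x <= c * nm x.
  exists `|c'| => // x; rewrite (le_trans (hc' x))// ler_wpM2r ?nm_ge0//.
  exact: ler_norm.
have phiN x : phi (- x) = - phi x.
  have -> : - x = (-1)%:C *: x by rewrite rmorphN1 scaleN1r.
  by rewrite phiZ mulN1r.
pose q x := ip (T x) x - 2 * phi x.
have qD x v : q (x + v) = q x + 2 * (ip (T x) v - phi v) + ip (T v) v.
  by rewrite /q (opE bT) !ipE phiD (ipC (T v) x) -sT; ring.
have q_lb x : - c ^+ 2 <= q x.
  rewrite /q; have := cT x; rewrite ipxx => h1; have h2 := hc x.
  by have := sqr_ge0 (nm x - c); lra.
have hinf : has_inf (range q).
  by split; [exists (q 0), 0 | exists (- c ^+ 2) => _ [x _ <-]].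
pose m := inf (range q).
have qm x : m <= q x by apply: ge_inf; [exact: hinf.2|exists x].
have : forall n : nat, exists x, q x < m + n.+1%:R^-1.
  move=> n; have [|_ [x _ <-] hx] := inf_adherent (_ : 0 < n.+1%:R^-1) hinf.
    by rewrite invr_gt0.
  by exists x.
move=> /choice [u hu].
(* Parallelogram law: [2 q(x) + 2 q(y) - 4 q((x + y)/2) = <T(x - y), x - y>], and the midpoint value
   is at least [m]. Hence minimizing sequences are Cauchy. *)
have upar x y : ip (x - y) (x - y) <= 2 * (q x - m) + 2 * (q y - m).
  have := qm ((2^-1)%:C *: (x + y)); have := cT (x - y).
  rewrite /q !(opE bT) phiZ phiD !ipE.
  by have := sT x y; have := ipC (T y) x; have := ipC y x; lra.
have small (e : R) : 0 < e -> exists N : nat, forall n, (N <= n)%N ->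
    q (u n) - m < e.
  move=> e0; exists (Num.truncn e^-1) => n Nn.
  rewrite ltrBlDl (lt_le_trans (hu n))// lerD2l.
  rewrite -[leRHS]invrK lef_pV2 ?posrE ?invr_gt0//.
  rewrite (le_trans (ltW (truncnS_gt _)))// ler_nat.
  by rewrite ltnS.
have [l hl] : exists l, forall e : R, 0 < e -> exists N : nat, forall n : nat,
     (N <= n)%N -> nm (u n - l) < e.
  apply: nm_complete => e e0.
  have [|N hN] := small (e ^+ 2 / 4); first by rewrite divr_gt0 ?exprn_gt0.
  exists N => i j Ni Nj.
  rewrite -ltr_sqr ?nnegrE ?nm_ge0 ?ltW// -ipxx.
  rewrite (le_lt_trans (upar _ _))//.
  by have := hN _ Ni; have := hN _ Nj; lra.
have qlm : q l <= m.
  apply/ler_addgt0Pr => e e0.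
  (* [k] dominates the linear part of [q (l + w) - q l], and the quadratic part is nonnegative, so
     [q l] exceeds [q (l + w)] by at most [k * nm w]. *)
  pose k := 2 * (nm (T l) + c) + 1.
  have k0 : 0 < k by rewrite /k; have := nm_ge0 (T l); lra.
  have [|N1 h1] := small (e / 2); first by rewrite divr_gt0.
  have [|N2 h2] := hl (e / 2 / k); first by rewrite !divr_gt0.
  have {}h1 := h1 _ (leq_maxl N1 N2); have {}h2 := h2 _ (leq_maxr N1 N2).
  set w := u _ - l in h2.
  have uw : u (maxn N1 N2) = l + w by rewrite /w addrC subrK.
  rewrite uw qD in h1.
  have Tw := le_trans (ipxx_ge0 w) (cT w).
  have := ip_le_nm (- T l) w; have := hc w; rewrite nmN ipNl => h3 h4.
  have : k * nm w < e / 2 by rewrite mulrC -ltr_pdivlMr.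
  rewrite /k; have := nm_ge0 w; lra.
(* First variation: [q] is minimal at [l], so its derivative in every direction [v] vanishes. *)
exists l => v; apply/eqP; rewrite -subr_eq0; apply/eqP.
apply: (@quad_ge0_linear _ (ip (T v) v)) => t.
have := le_trans qlm (qm (l + t%:C *: v)).
rewrite qD (opE bT) !ipE phiZ; lra.
Qed.

Lemma adjP A : bounded_op A ->
  bounded_op (adj A) /\ forall x y, ip (A x) y = ip x (adj A y).
Proof.
move=> bA.
have : forall y, exists w, forall v, ip w v = ip (A v) y.
  move=> y; apply: (@coercive_representation id) => //.
  - exact: bounded_op_id.
  - by move=> x z; rewrite (opE bA) ipDl.
  - by move=> a x; rewrite (opE bA) ipZl.
  - have [c _ hc] := op_bound bA; exists (c * nm y) => x.
    rewrite (le_trans (ip_le_nm _ _))// mulrAC ler_wpM2r ?nm_ge0//.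
move=> /choice [B hB].
have AB x y : ip (A x) y = ip x (B y) by rewrite (ipC x) hB.
have : exists B, bounded_op B /\ forall x y, dot (A x) y = dot x (B y).
  exists B; split; first exact: adjoint_bounded bA AB.
  move=> x y; rewrite !dot_ip AB -[in RHS](opprK (ip x ('i *: _))) -ip_il.
  by rewrite -(AB ('i *: x)) (opE bA) ip_il opprK.
move=> /getPex /= [bB hadj]; split=> // x y.
by rewrite /ip hadj.
Qed.

Lemma adj_unique A B : bounded_op A ->
  (forall x y, ip (A x) y = ip x (B y)) -> adj A = B.
Proof.
move=> bA AB; apply/funext => y; apply: ip_ext => z.
by rewrite !(ipC _ z) -AB (adjP bA).2.
Qed.

Lemma symmetric_adj A : bounded_op A -> symmetric_op A -> adj A = A.
Proof. by move=> bA sA; apply: adj_unique. Qed.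

Lemma adj_symmetric A : bounded_op A -> adj A = A -> symmetric_op A.
Proof. by move=> bA AA x y; rewrite (adjP bA).2 AA. Qed.

(** Solving [<Tw,v> = <y,v>] for all [v] gives surjectivity and coercivity gives injectivity; the
    bound comes from [|Ux|^2 <= <TUx,Ux> = <x,Ux>]. *)
Lemma coercive_inverse T : bounded_op T -> symmetric_op T ->
  (forall x, ip x x <= ip (T x) x) ->
  exists U, [/\ bounded_op U, symmetric_op U, forall x, T (U x) = x &
                forall x, U (T x) = x].
Proof.
move=> bT sT cT.
have : forall y, exists w, T w = y.
  move=> y; have [|||w hw] := @coercive_representation T (ip y) bT sT cT.
  - by move=> x z; rewrite ipDr.
  - by move=> a x; rewrite ipZr.
  - by exists (nm y) => x; apply: ip_le_nm.
  - by exists w; apply: ip_ext.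
move=> /choice [U TU].
have Tinj x y : T x = T y -> x = y.
  move=> xy; apply/eqP; rewrite -subr_eq0; apply/eqP/ipxx_eq0/le_anti.
  by rewrite ipxx_ge0 (le_trans (cT _))// !(opE bT) xy subrr ip0l.
have UT x : U (T x) = x by apply: Tinj; rewrite TU.
have sU : symmetric_op U by move=> x y; rewrite -{1}(TU y) -sT TU.
exists U; split=> //; apply: (@bounded_opI _ 1).
  by apply: (adjoint_linear _ sU) => x; apply: Tinj; rewrite (opE bT) !TU.
move=> x; rewrite mul1r; have := le_trans (cT (U x)) (ip_le_nm _ _).
rewrite TU ipxx.
have := nm_ge0 (U x); rewrite le_eqVlt => /orP[/eqP <- _|U0].
  exact: nm_ge0.
by rewrite expr2 ler_pM2r.
Qed.

End BoundedOperators.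

(** * Square roots of positive operators *)

Lemma archi_le0 (R : realType) (a c : R) :
  (forall n : nat, a <= c * n.+1%:R^-1) -> a <= 0.
Proof.
move=> h; rewrite leNgt; apply/negP => a0.
have := h (Num.truncn (c / a)).
rewrite leNgt => /negP; apply; rewrite ltr_pdivrMr// mulrC -ltr_pdivrMr//.
exact: truncnS_gt.
Qed.

Section SquareRoot.
Variables (R : realType) (H : hilbertType R).
Implicit Types (x y z : H) (a : R) (A B : H -> H).

Section Iteration.
Variable X : H -> H.
Hypotheses (bX : bounded_op X) (sX : symmetric_op X).
Hypothesis X1 : forall x, nm (X x) <= nm x.

(** A limit [L] satisfies [2 L = X + L^2], that is [(1 - L)^2 = 1 - X]: this is the square root of
    [1 - X] by successive approximation. *)
Fixpoint sqrt_iter n : H -> H :=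
  if n is n'.+1 then
    fun x => (2^-1)%:C *: (X x + sqrt_iter n' (sqrt_iter n' x))
  else fun=> 0.

(* The iteration for [X = 1], which dominates the increments of [sqrt_iter]. *)
Fixpoint scalar_iter n : R :=
  if n is n'.+1 then 2^-1 * (1 + scalar_iter n' ^+ 2) else 0.

Local Notation Y := sqrt_iter.
Local Notation r := scalar_iter.

Lemma bounded_sqrt_iter n : bounded_op (Y n).
Proof.
elim: n => [|n IH] /=.
  apply: (@bounded_opI _ _ _ 0) => [k x y|x]; first by rewrite scaler0 addr0.
  by rewrite mul0r /nm normr0.
by apply: bounded_opZ; apply: bounded_opD => //; apply: bounded_op_comp.
Qed.

Lemma symmetric_sqrt_iter n : symmetric_op (Y n).
Proof.
elim: n => [|n IH] x y /=; first by rewrite ip0l ip0r.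
by rewrite !ipE sX !IH.
Qed.

Lemma sqrt_iter_comm B n : bounded_op B -> (forall x, B (X x) = X (B x)) ->
  forall x, B (Y n x) = Y n (B x).
Proof.
move=> bB BX; elim: n => [|n IH] x /=; first exact: (op0 bB).
by rewrite !(opE bB) BX !IH.
Qed.

Lemma scalar_iter_ge0 n : 0 <= r n.
Proof. by elim: n => //= n IH; have := sqr_ge0 (r n); lra. Qed.

Lemma scalar_iter_le1 n : r n <= 1.
Proof. by elim: n => //= n IH; have := scalar_iter_ge0 n; nra. Qed.

(** The defect [d = 1 - r n] evolves by [d -> d (1 - d/2)], so [1/d] grows by at least [1/2] at each
    step. *)
Lemma scalar_iter_rate n : 1 - r n <= 2 * n.+1%:R^-1.
Proof.
elim: n => [|n IH] /=; first by rewrite invr1; lra.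
have h0 := scalar_iter_ge0 n; have h1 := scalar_iter_le1 n.
set d := 1 - r n in IH; have rd : r n = 1 - d by rewrite /d; lra.
have -> : 1 - 2^-1 * (1 + r n ^+ 2) = d * (1 - d / 2) by rewrite rd; field.
have n0 : 0 < n.+1%:R :> R by [].
have e2 : n.+2%:R = n.+1%:R + 1 :> R by rewrite -natr1.
rewrite e2 ler_pdivlMr ?addr_gt0//.
move: IH; rewrite ler_pdivlMr//; set k : R := n.+1%:R in n0 * => IH.
have d2 : 0 <= 1 - d / 2 by lra.
have : 0 <= (2 - d * k) * (1 - d / 2) by rewrite mulr_ge0// subr_ge0.
by have := sqr_ge0 d; lra.
Qed.

Lemma sqrt_iter_bound n x : nm (Y n x) <= r n * nm x.
Proof.
elim: n x => [|n IH] x /=; first by rewrite mul0r /nm normr0.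
rewrite nmZ ger0_norm ?lecR ?invr_ge0//= -mulrA ler_wpM2l ?invr_ge0//.
rewrite (le_trans (nm_triangle _ _))// mulrDl mul1r lerD//.
rewrite (le_trans (IH _))// expr2 -mulrA ler_wpM2l ?IH//.
exact: scalar_iter_ge0.
Qed.

Lemma sqrt_iter_le1 n x : nm (Y n x) <= nm x.
Proof.
rewrite (le_trans (sqrt_iter_bound _ _))// ler_piMl ?nm_ge0//.
exact: scalar_iter_le1.
Qed.

Lemma sqrt_iter_step n x : nm (Y n.+1 x - Y n x) <= (r n.+1 - r n) * nm x.
Proof.
elim: n x => [|n IH] x.
  have := sqrt_iter_bound 1 x; rewrite !subr0 => /le_trans; exact.
(* The difference of squares is split as [Y' (Y' - Y) + (Y' - Y) Y]; bounding each factor reproduces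
   the recursion of [r]. *)
have -> : Y n.+2 x - Y n.+1 x =
    (2^-1)%:C *: (Y n.+1 (Y n.+1 x - Y n x) + (Y n.+1 (Y n x) - Y n (Y n x))).
  rewrite (opD (bounded_sqrt_iter n.+1)) (opN (bounded_sqrt_iter n.+1)).
  have YS k : Y k.+1 x = (2^-1)%:C *: (X x + Y k (Y k x)) by [].
  by rewrite [X in _ - X = _]YS [X in X - _ = _]YS; vec.
rewrite nmZ ger0_norm ?lecR ?invr_ge0// [complex.Re _]/=.
have h1 := sqrt_iter_bound n.+1 (Y n.+1 x - Y n x).
have h2 := IH (Y n x); have h3 := IH x; have h4 := sqrt_iter_bound n x.
have h5 := le_trans h1 (ler_wpM2l (scalar_iter_ge0 n.+1) h3).
have d0 : 0 <= r n.+1 - r n.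
  by rewrite /=; have := sqr_ge0 (1 - r n); lra.
have h6 := le_trans h2 (ler_wpM2l d0 h4).
have h7 := nm_triangle (Y n.+1 (Y n.+1 x - Y n x))
  (Y n.+1 (Y n x) - Y n (Y n x)).
have -> : (r n.+2 - r n.+1) * nm x =
    2^-1 * (r n.+1 * ((r n.+1 - r n) * nm x) + (r n.+1 - r n) * (r n * nm x)).
  rewrite -[r n.+2]/(2^-1 * (1 + r n.+1 ^+ 2)).
  have rE : 2^-1 * (1 + r n ^+ 2) = r n.+1 by [].
  move: (r n.+1) rE => s rE; rewrite -[X in (_ - X) * _ = _]rE; ring.
by rewrite ler_wpM2l ?invr_ge0//; lra.
Qed.

Lemma sqrt_iter_dist n k x : nm (Y (n + k) x - Y n x) <= 2 * n.+1%:R^-1 * nm x.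
Proof.
have h : nm (Y (n + k) x - Y n x) <= (r (n + k) - r n) * nm x.
  elim: k => [|k IH]; first by rewrite addn0 !subrr mul0r /nm normr0.
  rewrite addnS.
  have -> : Y (n + k).+1 x - Y n x =
      (Y (n + k).+1 x - Y (n + k) x) + (Y (n + k) x - Y n x).
    by rewrite addrA subrK.
  rewrite (le_trans (nm_triangle _ _))//.
  by have := sqrt_iter_step (n + k) x; lra.
rewrite (le_trans h)// ler_wpM2r ?nm_ge0// (le_trans _ (scalar_iter_rate n))//.
by rewrite lerD2r scalar_iter_le1.
Qed.

Lemma sqrt_iter_limit : exists L : H -> H,
  forall n x, nm (Y n x - L x) <= 2 * n.+1%:R^-1 * nm x.
Proof.
have h x n m : (n <= m)%N -> nm (Y n x - Y m x) <= 2 * nm x * n.+1%:R^-1.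
  by move=> /subnKC <-; rewrite nm_distC mulrAC sqrt_iter_dist.
have : forall x, exists l, forall e : R, 0 < e -> exists N : nat,
    forall n : nat, (N <= n)%N -> nm (Y n x - l) < e.
  move=> x; apply: nm_complete => e e0.
  have [N hN] : exists N : nat, 2 * nm x * N.+1%:R^-1 < e / 2.
    apply: contrapT => /forallNP hN.
    have /archi_le0 : forall n : nat, e / 2 <= 2 * nm x * n.+1%:R^-1.
      by move=> n; rewrite leNgt; apply/negP/hN.
    by lra.
  exists N => m n Nm Nn.
  have -> : Y m x - Y n x = (Y N x - Y n x) - (Y N x - Y m x) by vec.
  rewrite (le_lt_trans (nm_triangle _ _))// nmN.
  move: hN (h x _ _ Nm) (h x _ _ Nn); move: (_ * N.+1%:R^-1) => c.
  by move: (nm _) (nm _) => p q; lra.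
move=> /choice [L hL]; exists L => n x.
apply/ler_addgt0Pr => e e0; have [N hN] := hL x e e0.
have := hN _ (leq_maxr n N); have := h x _ _ (leq_maxl n N).
have -> : Y n x - L x = (Y n x - Y (maxn n N) x) + (Y (maxn n N) x - L x).
  by rewrite addrA subrK.
move=> h1 h2; rewrite (le_trans (nm_triangle _ _))//.
by rewrite mulrAC lerD// ltW.
Qed.

Lemma half_square_fixpoint : exists L : H -> H,
  [/\ bounded_op L, symmetric_op L, forall x, nm (L x) <= nm x,
      forall x, X x + L (L x) = 2%:C *: L x &
      forall B, bounded_op B -> (forall x, B (X x) = X (B x)) ->
        forall x, B (L x) = L (B x)].
Proof.
have [L hL] := sqrt_iter_limit; exists L.
have L1 x : nm (L x) <= nm x.
  rewrite -subr_le0; apply: (@archi_le0 _ _ (2 * nm x)) => n.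
  have -> : L x = Y n x - (Y n x - L x) by rewrite subKr.
  have := nm_triangle (Y n x) (- (Y n x - L x)); rewrite nmN.
  move: (hL n x) (sqrt_iter_le1 n x); move: n.+1%:R^-1 => i; lra.
have sL : symmetric_op L.
  have le x y : ip (L x) y - ip x (L y) <= 0.
    apply: (@archi_le0 _ _ (4 * nm x * nm y)) => n.
    have := ip_le_nm (- (Y n x - L x)) y; have := ip_le_nm x (Y n y - L y).
    rewrite !ipE nmN symmetric_sqrt_iter.
    have := ler_wpM2l (nm_ge0 x) (hL n y).
    by have := ler_wpM2r (nm_ge0 y) (hL n x); move: n.+1%:R^-1 => i; lra.
  move=> x y; apply/eqP; rewrite eq_le -subr_le0 le -subr_le0 /=.
  by rewrite (ipC x) (ipC _ y) le.
have cL B : bounded_op B -> (forall x, B (X x) = X (B x)) ->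
    forall x, B (L x) = L (B x).
  move=> bB BX x; have [c c0 hc] := op_bound bB.
  apply/eqP; rewrite -subr_eq0; apply/eqP/nm0_eq0/le_anti.
  rewrite nm_ge0 andbT.
  apply: (@archi_le0 _ _ (2 * (c * nm x + nm (B x)))) => n.
  have -> : B (L x) - L (B x) = - B (Y n x - L x) + (Y n (B x) - L (B x)).
    rewrite -(sqrt_iter_comm n bB BX) !(opE bB); vec.
  rewrite (le_trans (nm_triangle _ _))// nmN.
  have := le_trans (hc (Y n x - L x)) (ler_wpM2l (ltW c0) (hL n x)).
  by have := hL n (B x); move: n.+1%:R^-1 => i; lra.
split=> //.
- apply: (@bounded_opI _ _ _ 1) => [|x]; last by rewrite mul1r.
  (* [L] is its own adjoint, so only commutation with ['i] remains; this is an instance of [cL]. *)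
  apply: (adjoint_linear _ sL) => x; apply/esym.
  apply: (cL (fun x => 'i *: x)) => [|y]; last by rewrite (opE bX).
  by apply: bounded_opZ; apply: bounded_op_id.
- move=> x; apply/eqP; rewrite -subr_eq0; apply/eqP/nm0_eq0/le_anti.
  rewrite nm_ge0 andbT; apply: (@archi_le0 _ _ (8 * nm x)) => n.
  (* The index [n.+1] lets [2 Y n.+1 x = X x + Y n (Y n x)] absorb [X x] exactly, leaving only
     approximation errors. *)
  pose u := Y n.+1 x - L x.
  have -> : X x + L (L x) - 2%:C *: L x =
      2%:C *: u - (Y n (Y n x - L x) + (Y n (L x) - L (L x))).
    rewrite (opD (bounded_sqrt_iter n)) (opN (bounded_sqrt_iter n)) /u /=.
    by vec.
  have t1 := nm_triangle (2%:C *: u)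
    (- (Y n (Y n x - L x) + (Y n (L x) - L (L x)))).
  have t2 := nm_triangle (Y n (Y n x - L x)) (Y n (L x) - L (L x)).
  rewrite nmN nmZ ger0_norm ?lecR//= in t1.
  have h1 := le_trans (sqrt_iter_le1 n (Y n x - L x)) (hL n x).
  have i0 : 0 <= n.+1%:R^-1 :> R by rewrite invr_ge0.
  have h2 : nm (Y n (L x) - L (L x)) <= 2 * n.+1%:R^-1 * nm x.
    by rewrite (le_trans (hL n _))// ler_wpM2l// mulr_ge0.
  have h3 : nm u <= 2 * n.+1%:R^-1 * nm x.
    rewrite (le_trans (hL n.+1 x))// ler_wpM2r ?nm_ge0// ler_wpM2l//.
    by rewrite lef_pV2 ?posrE// ler_nat.
  by move: t1 t2 h1 h2 h3; move: n.+1%:R^-1 => i; lra.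
Qed.

End Iteration.

(** With [c] a bound of [A], the operator [X = 1 - A/c] lies between 0 and 1, and [sqrt c * (1 - L)]
    squares to [c (1 - X) = A]. *)
Theorem psd_sqrt A : psd A -> exists S : H -> H,
  [/\ psd S, forall x, S (S x) = A x &
      forall B, bounded_op B -> (forall x, B (A x) = A (B x)) ->
        forall x, B (S x) = S (B x)].
Proof.
move=> pA; have bA := pA.1; have sA := psd_symmetric pA.
have [c c0 hc] := op_bound bA.
have [X XE] : exists X, forall x, X x = x - c^-1%:C *: A x by eexists.
have bX : bounded_op X.
  rewrite (funext XE).
  by apply: bounded_opB; [exact: bounded_op_id|exact: bounded_opZ].
have sX : symmetric_op X by move=> x y; rewrite !XE !ipE sA.
have X0 x : 0 <= ip (X x) x.
  rewrite !XE !ipE subr_ge0 ler_pdivrMl// (le_trans (ip_le_nm _ _))// ipxx.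
  by rewrite expr2 mulrA ler_wpM2r ?nm_ge0.
have Xle x : ip (X x) x <= ip x x.
  by rewrite !XE !ipE gerDl oppr_le0 mulr_ge0 ?psd_ge0// invr_ge0 ltW.
have X1 x : nm (X x) <= nm x.
  rewrite -ler_sqr ?nnegrE ?nm_ge0// -!ipxx.
  (* Expanding [<X(x - Xx), x - Xx> >= 0] and using [X <= 1] at [x] and at [Xx] gives
     [2 |Xx|^2 <= |x|^2 + |Xx|^2]. *)
  have := X0 (x - X x); have := Xle x; have := Xle (X x).
  by rewrite (opD bX) (opN bX) !ipE (sX (X x) x); lra.
have [L [bL sL L1 XL cL]] := half_square_fixpoint bX sX X1.
pose s := Num.sqrt c.
have s2 : s * s = c by rewrite -expr2 sqr_sqrtr// ltW.
exists (fun x => s%:C *: (x - L x)).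
have bS : bounded_op (fun x => s%:C *: (x - L x)).
  by apply: bounded_opZ; apply: bounded_opB => //; exact: bounded_op_id.
split.
- apply: psdI => // [x y|x]; first by rewrite !ipE sL.
  rewrite !ipE mulr_ge0 ?sqrtr_ge0// subr_ge0 (le_trans (ip_le_nm _ _))//.
  by rewrite ipxx expr2 ler_wpM2r ?nm_ge0.
- move=> x; rewrite (opZ bL) scalerBr -!scalerBr (opD bL) (opN bL).
  rewrite scalerA -rmorphM s2.
  have -> : x - L x - (L x - L (L x)) = x - 2%:C *: L x + L (L x) by vec.
  rewrite -XL XE; apply: ip_ext => z; rewrite !ipE.
  by field; rewrite gt_eqF.
- move=> B bB BA x; rewrite !(opE bB) (cL B)// => y.
  by rewrite !XE !(opE bB) BA.
Qed.

(** The form is nonnegative along [x + t Ax], where its linear coefficient is [|Ax|^2]. *)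
Lemma psd_ip0 A x : psd A -> ip (A x) x = 0 -> A x = 0.
Proof.
move=> pA Ax; have bA := pA.1; apply: ipxx_eq0.
apply: (@quad_ge0_linear _ _ (ip (A (A x)) (A x))) => t.
have := psd_ge0 (x + t%:C *: A x) pA.
by rewrite !(opE bA) !ipE Ax (psd_symmetric pA (A x) x); lra.
Qed.

(** For [D = A - B], commutation gives [(A + B) D = 0]; by positivity [A D = B D = 0], so the
    symmetric [D] has [D^2 = 0]. *)
Lemma comm_sqrt_unique A B : psd A -> psd B ->
  (forall x, A (B x) = B (A x)) -> (forall x, A (A x) = B (B x)) -> A = B.
Proof.
move=> pA pB AB A2; have bA := pA.1; have bB := pB.1.
apply/funext => x; apply/eqP; rewrite -subr_eq0; apply/eqP.
pose D y := A y - B y.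
have sD : symmetric_op D.
  by move=> y z; rewrite /D !ipE (psd_symmetric pA) (psd_symmetric pB).
have D0 y : A (D y) = 0 /\ B (D y) = 0.
  have e : ip (A (D y)) (D y) + ip (B (D y)) (D y) = 0.
    have -> : B (D y) = - A (D y).
      by rewrite /D !(opE bA) !(opE bB) A2 AB opprD opprK addrC.
    by rewrite ipNl subrr.
  have := psd_ge0 (D y) pA; have := psd_ge0 (D y) pB => h1 h2.
  by split; apply: psd_ip0 => //; lra.
apply: ipxx_eq0; rewrite -/(D x) sD {1}/D.
by have [-> ->] := D0 x; rewrite subrr ip0r.
Qed.

(** [A] and [B] need not commute a priori; each is compared with the root from [psd_sqrt], which
    commutes with whatever commutes with the square. *)
Theorem psd_sqrt_unique A B : psd A -> psd B ->
  (forall x, A (A x) = B (B x)) -> A = B.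
Proof.
move=> pA pB A2.
have p2 : psd (fun x => A (A x)).
  apply: psdI => [|x y|x]; first exact: bounded_op_comp pA.1 pA.1.
  - by rewrite !(psd_symmetric pA).
  - by rewrite (psd_symmetric pA) ipxx_ge0.
have [S [pS S2 cS]] := psd_sqrt p2.
have -> : A = S.
  by apply: comm_sqrt_unique => // x; apply: cS => //; exact: pA.1.
apply/esym/comm_sqrt_unique => // x; last by rewrite S2 A2.
by apply: cS; [exact: pB.1|move=> y; rewrite !A2].
Qed.

End SquareRoot.

(** * Absolute values and range projections *)

Section Symmetries.
Variables (R : realType) (H : hilbertType R).
Implicit Types (x y z : H) (A B : H -> H).

Lemma abs_op_eq A M : bounded_op A -> symmetric_op A -> psd M ->
  (forall x, M (M x) = A (A x)) -> abs_op A = M.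
Proof.
move=> bA sA pM M2; rewrite /abs_op (symmetric_adj bA sA).
have : exists B, psd B /\ B \o B = A \o A.
  by exists M; split=> //; apply/funext => x /=.
move=> /getPex [pB B2]; apply: psd_sqrt_unique => // x.
by rewrite M2; exact: (congr1 (@^~ x) B2).
Qed.

(** Equal ranges give [Q P = P] and [P Q = Q]; taking adjoints identifies the two. *)
Lemma orth_proj_unique (P Q : H -> H) :
  symmetric_op P -> (forall x, P (P x) = P x) ->
  symmetric_op Q -> (forall x, Q (Q x) = Q x) ->
  range P = range Q -> P = Q.
Proof.
move=> sP PP sQ QQ PQ; apply/funext => x.
have QP y : Q (P y) = P y.
  by have [z _ <-] : range Q (P y) by rewrite -PQ; exists y.
have PQ' y : P (Q y) = Q y.
  by have [z _ <-] : range P (Q y) by rewrite PQ; exists y.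
by apply: ip_ext => z; rewrite -QP sQ sP PQ' sQ.
Qed.

Lemma closure_range_proj (P : H -> H) : bounded_op P ->
  (forall x, P (P x) = P x) -> closure (range P) = range P.
Proof.
move=> bP PP; apply/seteqP; split; last exact: subset_closure.
move=> x clx; exists x => //; apply/eqP; rewrite -subr_eq0.
apply/eqP/nm0_eq0/le_anti; rewrite nm_ge0 andbT.
have [c c0 hc] := op_bound bP.
apply/ler_addgt0Pr => e e0; rewrite add0r.
(* For [Py] near [x], [Px - x = P(x - Py) - (x - Py)] has norm at most [(c + 1) |x - Py|], whence
   this radius. *)
have d0 : 0 < e / (c + 1) by rewrite divr_gt0// ltr_wpDl// ltW.
have /clx [_ [[y _ <-] ]] : nbhs x (ball x (e / (c + 1))%:C).
  by apply: nbhsx_ballx; rewrite ltcR.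
rewrite -ball_normE /= nmE ltcR => xy.
have -> : P x - x = P (x - P y) - (x - P y).
  by rewrite (opD bP) (opN bP) PP; vec.
rewrite (le_trans (nm_triangle _ _))// nmN (le_trans (lerD (hc _) (lexx _)))//.
rewrite -[X in _ + X]mul1r -mulrDl mulrC -ler_pdivlMr ?ltr_wpDl ?ltW//.
Qed.

Lemma range_proj_eq A (P : H -> H) : bounded_op P -> symmetric_op P ->
  (forall x, P (P x) = P x) -> range A = range P -> range_proj A = P.
Proof.
move=> bP sP PP AP; rewrite /range_proj AP closure_range_proj//.
have : exists Q, [/\ bounded_op Q, Q \o Q = Q, adj Q = Q & range Q = range P].
  exists P; split=> //; first exact/funext.
  exact: symmetric_adj.
move=> /getPex [bQ QQ aQ QP]; apply: orth_proj_unique => //.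
  exact: adj_symmetric.
by move=> x; exact: (congr1 (@^~ x) QQ).
Qed.

(** [S] is the modulus of [K] and [V] its inverse, built as [S (K^2)^-1] because coercivity is first
    known only for [K^2]. *)
Lemma modulus_inverse (K : H -> H) : bounded_op K -> symmetric_op K ->
  (forall x, ip x x <= ip (K x) (K x)) ->
  exists S V : H -> H,
  [/\ psd S, psd V, forall x, S (S x) = K (K x) /\ ip x x <= ip (S x) x,
      forall x, S (V x) = x /\ V (S x) = x &
      forall B, bounded_op B -> (forall x, B (K (K x)) = K (K (B x))) ->
        forall x, B (S x) = S (B x) /\ B (V x) = V (B x)].
Proof.
move=> bK sK K1.
have bT : bounded_op (fun x => K (K x)) by apply: bounded_op_comp.
have sT : symmetric_op (fun x => K (K x)) by move=> x y; rewrite !sK.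
have cT x : ip x x <= ip (K (K x)) x by rewrite sK.
have pT : psd (fun x => K (K x)).
  by apply: psdI => // x; rewrite sK ipxx_ge0.
have [S [pS S2 cS]] := psd_sqrt pT.
have [U [bU sU TU UT]] := coercive_inverse bT sT cT.
have SU x : U (S x) = S (U x).
  by rewrite -{1}(TU x) -S2 S2 UT.
pose V x := S (U x).
have SV x : S (V x) = x by rewrite /V S2 TU.
have VS x : V (S x) = x by rewrite /V SU S2 TU.
have sS := psd_symmetric pS.
have bV : bounded_op V by apply: bounded_op_comp bU; exact: pS.1.
have sV : symmetric_op V by move=> x y; rewrite -{1}(SV y) -sS SV.
have pV : psd V.
  by apply: psdI => // x; rewrite -{2}(SV x) -sS psd_ge0.
exists S, V; split=> //.
- move=> x; split; first exact: S2.
  have V1 : ip (V x) (V x) <= ip x x.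
    by have := K1 (V x); rewrite -sK -S2 sS SV.
  have Vx : ip (V x) x <= ip x x.
    rewrite (le_trans (ip_le_nm _ _))// ipxx expr2 ler_wpM2r ?nm_ge0//.
    by rewrite -ler_sqr ?nnegrE ?nm_ge0// -!ipxx.
  (* Since [S V = 1], positivity of [S] at [x - Vx] reads [<Sx,x> >= 2 |x|^2 - <Vx,x>], and
     [V <= 1]. *)
  have := psd_ge0 (x - V x) pS.
  rewrite (opD pS.1) (opN pS.1) SV !ipE (sS x (V x)) SV (ipC x (V x)).
  by lra.
- move=> B bB BK x; have BS := cS B bB BK; split=> //.
  by rewrite -{2}(SV x) BS VS.
Qed.

End Symmetries.

(** * The least symmetry [J] with [J E] positive *)

Theorem theorem15 (R : realType) (H : hilbertType R) (E : H -> H)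
    (E_bounded : bounded_op E) (E_idem : E \o E = E) :
  loewner_minimum
    [set J : H -> H | [/\ bounded_op J, psd (J \o E), J = adj J &
                          inverse_op J J]]
    (2 *: range_proj (pos_part (E + adj E)) - id).
Proof.
have EE x : E (E x) = E x by exact: (congr1 (@^~ x) E_idem).
have bE := E_bounded; have [bF EF] := adjP bE.
set F := adj E in bF EF *.
have FE x y : ip (F x) y = ip x (E y) by rewrite ipC -EF ipC.
have FF x : F (F x) = F x by apply: ip_ext => z; rewrite !FE EE.
have [K KE] : exists K : H -> H, forall x, K x = E x + F x - x by eexists.
have bK : bounded_op K.
  rewrite (funext KE); apply: bounded_opB; last exact: bounded_op_id.
  exact: bounded_opD.
have sK : symmetric_op K by move=> x y; rewrite !KE !ipE EF FE; ring.
have K1 x : ip x x <= ip (K x) (K x).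
  have e1 : ip (E x) (F x) = ip (E x) x by rewrite -EF EE.
  have := ipxx_ge0 (E x - F x).
  by rewrite KE !ipE (ipC (F x) (E x)) e1 (FE x x) -(EF x x) (ipC x (E x)); lra.
have [S [V [pS pV SK SV cSV]]] := modulus_inverse bK sK K1.
have KEx x : K (E x) = F (E x) by rewrite KE EE addrAC subrr add0r.
have KFx x : K (F x) = E (F x) by rewrite KE FF addrK.
have EKx x : E (K x) = E (F x).
  by rewrite KE !(opE bE) EE addrAC subrr add0r.
have FKx x : F (K x) = F (E x) by rewrite KE !(opE bF) FF addrK.
have cF x : F (S x) = S (F x) /\ F (V x) = V (F x).
  (* [F K^2] and [K^2 F] both equal [F E F]. *)
  by apply: cSV => // y; rewrite FKx EKx KFx KEx.
have cK x : K (S x) = S (K x) /\ K (V x) = V (K x) by apply: cSV.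
have [J JE] : exists J : H -> H, forall x, J x = K (V x) by eexists.
have bJ : bounded_op J.
  by rewrite (funext JE); apply: bounded_op_comp => //; exact: pV.1.
have sS := psd_symmetric pS; have sV := psd_symmetric pV.
have sJ : symmetric_op J by move=> x y; rewrite !JE sK sV (cK y).2.
have JJ x : J (J x) = x.
  by rewrite !JE -(cK (V x)).2 -(SK (V (V x))).1 (SV (V x)).1 (SV x).1.
have JS x : J (S x) = K x by rewrite JE (SV x).2.
have SJ x : S (J x) = K x by rewrite JE -(cK (V x)).1 (SV x).1.
have nJ x : ip (J x) (J x) = ip x x by rewrite sJ JJ.
have [A AE] : exists A, E + F = A by eexists.
have AK x : A x = K x + x by rewrite -AE KE subrK.
have sA : symmetric_op A by move=> x y; rewrite !AK !ipE sK.
have bA : bounded_op A by rewrite -AE; exact: bounded_opD bE bF.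
rewrite AE.
have pM : psd (fun x => S x + J x).
  apply: psdI; first by apply: bounded_opD => //; exact: pS.1.
    by move=> x y; rewrite !ipE sS sJ.
  (* [S >= 1], and [|x + Jx|^2 >= 0] says [J >= -1]. *)
  move=> x; have := ipxx_ge0 (x + J x); have := (SK x).2.
  by rewrite !ipE nJ (ipC x (J x)); lra.
have absA : abs_op A = (fun x => S x + J x).
  (* [S J = J S = K] gives [(S + J)^2 = K^2 + 2 K + 1 = (K + 1)^2]. *)
  apply: abs_op_eq => // x; rewrite !AK (opD bK) (opD pS.1) (opD bJ).
  by rewrite (SK x).1 JS SJ JJ; vec.
have [P PE] : exists P : H -> H, forall x, P x = (2^-1)%:C *: (x + J x).
  by eexists.
have posA x : pos_part A x = P (S x + x).
  rewrite /pos_part absA !fctE AK PE (opD bJ) JS.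
  have -> : (2^-1 : R[i]) = (2^-1)%:C by rewrite fmorphV rmorph_nat.
  by vec.
have PA : range_proj (pos_part A) = P.
  apply: range_proj_eq.
  - rewrite (funext PE); apply: bounded_opZ; apply: bounded_opD => //.
    exact: bounded_op_id.
  - by move=> x y; rewrite !PE !ipE sJ.
  - by move=> x; rewrite !PE !(opE bJ) JJ; vec.
  (* [W] inverts the coercive [S + 1], so [P (S + 1)] has the same range as [P]. *)
  have [||| W [_ _ SW _]] := @coercive_inverse _ _ (fun x => S x + x).
  - by apply: bounded_opD; [exact: pS.1|exact: bounded_op_id].
  - by move=> x y; rewrite !ipE sS.
  - by move=> x; rewrite !ipE lerDr psd_ge0.
  apply/seteqP; split=> _ [x _ <-]; first by rewrite posA; exists (S x + x).
  by exists (W x) => //; rewrite posA SW.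
have -> : 2 *: range_proj (pos_part A) - id = J.
  apply/funext => x; rewrite PA !fctE PE.
  have -> : (2 : R[i]) = 2%:C by rewrite rmorph_nat.
  by vec.
split.
  split=> //.
  - have JEE x : J (E x) = V (F (E x)) by rewrite JE (cK (E x)).2 KEx.
    (* Moving [F] across the product turns [J E] into the form [<V E x, E y>], visibly symmetric and
       positive. *)
    have JV x y : ip (J (E x)) y = ip (V (E x)) (E y).
      by rewrite JEE -(cF (E x)).2 FE.
    apply: psdI; first exact: bounded_op_comp.
      by move=> x y; rewrite /= JV (ipC x) JV sV ipC.
    by move=> x; rewrite /= JV psd_ge0.
  - by apply/esym/symmetric_adj.
  - by split; apply/funext.
move=> G [bG pGE aG [GG' _]].
have GG x : G (G x) = x by exact: (congr1 (@^~ x) GG').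
have sG : symmetric_op G by apply: adj_symmetric.
have sGE x y : ip (G (E x)) y = ip x (G (E y)) by exact: (psd_symmetric pGE).
(* [F G] is the adjoint of the symmetric operator [G E]. *)
have FG x : F (G x) = G (E x) by apply: ip_ext => z; rewrite FE sG sGE.
have GF x : G (F x) = E (G x) by rewrite -{1}(GG x) FG GG.
have GK x : G (K x) = K (G x) by rewrite !KE !(opE bG) GF -FG (addrC (E _)).
have cG x : G (J x) = J (G x).
  have [] := cSV G bG _ x => [y|_ h]; first by rewrite !GK.
  by rewrite !JE GK h.
have w0 x : G x - J x = x - G (J x).
  (* [w = (1 - G)(1 + J) x] lies in the -1 eigenspace of [G] and in the +1 eigenspace of [J]. *)
  have [w wE] : exists w, w = x - G x + J x - G (J x) by eexists.
  have Gw : G w = - w by rewrite wE !(opE bG) !GG; vec.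
  have Jw : J w = w by rewrite wE !(opE bJ) !cG !JJ; vec.
  suff : w = 0.
    move=> w0; apply: ip_ext => z.
    by have := congr1 (fun y => ip y z) w0; rewrite wE !ipE; lra.
  have h1 : 0 <= ip (G (E w)) w by exact: (psd_ge0 w pGE).
  have h2 : 0 <= ip (E w) w.
    have : 0 <= ip (V (E w)) (E w) by apply: psd_ge0.
    by rewrite -{4}Jw -sJ JE (cK (E w)).2 KEx -(cF (E w)).2 FE.
  have h3 := psd_ge0 w pS.
  rewrite sG Gw ipNr in h1.
  have : ip (S w) w = 2 * ip (E w) w - ip w w.
    by rewrite -{1}Jw SJ KE !ipE FE (ipC w); ring.
  move=> h4; apply/ipxx_eq0/le_anti; rewrite ipxx_ge0 andbT; lra.
have nG x : ip (G x) (G x) = ip x x by rewrite sG GG.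
apply: psdI; first exact: bounded_opB bG bJ.
  by move=> x y; rewrite !fctE !ipE sG sJ.
move=> x; rewrite !fctE w0.
(* By [w0] the form of [G - J] at [x] is [|x|^2 - <GJx,x>], which is half of [|Gx - Jx|^2]. *)
have := ipxx_ge0 (G x - J x); rewrite !ipE nG nJ (ipC (J x) (G x)).
by rewrite (sG x) (ipC (G _) x); lra.
Qed.
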